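(* Let $n$ be a positive integer. The universal Tutte polynomial $\mathscr{T}_n(x,y,(z_I)_{\varnothing\neq I\subseteq[n]})$ has the following symmetries: (1) (affine translations) $\mathscr{T}_n(x,y,(z_I))=\mathscr{T}_n\big(x,y,(z_I+\sum_{i\in I}t_i)\big)$, for formal variables $t_1,\dots,t_n$. (2) (duality) $\mathscr{T}_n(x,y,(z_I))=\mathscr{T}_n\big(y,x,(z_{[n]\setminus I}-z_{[n]})\big)$, with the convention $z_\varnothing=0$. (3) ($S_n$-symmetry) $\mathscr{T}_n(x,y,(z_I))=\mathscr{T}_n(x,y,(z_{w(I)}))$ for any permutation $w\in S_n$.
   Context: Notation: $[n]=\{1,\dots,n\}$; $\mathbf e_1,\dots,\mathbf e_n$ is the canonical basis of $\mathbb{R}^n$; $w(I)$ is the image of $I$ under $w$. $\mathscr{T}_n(x,y,(c_I))$ denotes the result of substituting $c_I$ for $z_I$, for every nonempty $I\subseteq[n]$. The universal Tutte polynomial $\mathscr{T}_n(x,y,(z_I))$ is the unique polynomial (with rational coefficients) in $x,y$ and variables $z_I$ ($\varnothing\ne I\subseteq[n]$) such that for every submodular function $f:2^{[n]}\to\mathbb{Z}$, substituting $z_I=f(I)$ for all $I$ gives $\mathscr{T}_{P_f}(x,y)$ (existence and uniqueness are known). Here $f:2^{[n]}\to\mathbb{Z}$ is submodular if $f(\varnothing)=0$ and $f(I)+f(J)\ge f(I\cup J)+f(I\cap J)$ for all $I,J$, and $$P_f=\Big\{\mathbf x\in\mathbb{Z}^n\ \Big|\ \sum_{i\in I}x_i\le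 f(I)\ \text{for all } I\subseteq[n],\ \text{and}\ \sum_{i\in[n]}x_i=f([n])\Big\}.$$ For $P=P_f$ and $\mathbf a\in P$, an index $i\in[n]$ is internally active if there is no $j<i$ with $\mathbf a-\mathbf e_i+\mathbf e_j\in P$, and externally active if there is no $j<i$ with $\mathbf a+\mathbf e_i-\mathbf e_j\in P$; $\mathrm{Int}(\mathbf a),\mathrm{Ext}(\mathbf a)$ are the sets of such indices, and $$\mathscr{T}_P(x,y)=\sum_{\mathbf a\in P}x^{|\mathrm{Int}(\mathbf a)\setminus\mathrm{Ext}(\mathbf a)|}\,y^{|\mathrm{Ext}(\mathbf a)\setminus\mathrm{Int}(\mathbf a)|}\,(x+y-1)^{|\mathrm{Int}(\mathbf a)\cap\mathrm{Ext}(\mathbf a)|}.$$ *)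

(* Defs.v *)
(* The classical files come first so that [set0], [setT], etc. denote the
   finset versions. *)
From mathcomp Require Import boolp classical_sets functions cardinality fsbigop.
From mathcomp Require Import mpoly.
From mathcomp Require Import all_boot all_order all_algebra all_fingroup.

Set Implicit Arguments.
Unset Strict Implicit.
Unset Printing Implicit Defensive.

Import GRing.Theory.
Local Open Scope ring_scope.

(* The index set [n] = {1, ..., n} is 'I_n = {0, ..., n-1}. *)

Definition submodular (n : nat) (f : {set 'I_n} -> int) : Prop :=
  f set0 = 0 /\
  forall I J : {set 'I_n}, f (I :|: J) + f (I :&: J) <= f I + f J.

Definition Pf (n : nat) (f : {set 'I_n} -> int) : pred 'rV[int]_n :=
  [pred x : 'rV[int]_n |
    [forall I : {set 'I_n}, \sum_(i in I) x 0 i <= f I]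
    && (\sum_(i < n) x 0 i == f [set: 'I_n])].

Definition basis_vec (n : nat) (i : 'I_n) : 'rV[int]_n := delta_mx 0 i.

Definition Int (n : nat) (P : pred 'rV[int]_n) (a : 'rV[int]_n) : {set 'I_n} :=
  [set i : 'I_n | ~~ [exists j : 'I_n,
     (j < i)%N && (a - basis_vec i + basis_vec j \in P)]].

Definition Ext (n : nat) (P : pred 'rV[int]_n) (a : 'rV[int]_n) : {set 'I_n} :=
  [set i : 'I_n | ~~ [exists j : 'I_n,
     (j < i)%N && (a + basis_vec i - basis_vec j \in P)]].

(* Q[x, y], with x = 'X_0 and y = 'X_1. *)
Notation bipoly := {mpoly rat[2]}.
Definition bix : bipoly := 'X_0.
Definition biy : bipoly := 'X_1.

(* The sum is finitely supported summation: it is the sum over P as soon as P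
   is finite, which is the case of Pf f (f submodular), and 0 on infinite
   supports. *)
Definition tutte (n : nat) (P : pred 'rV[int]_n) : bipoly :=
  \sum_(a \in [set` P]%classic)
    (bix ^+ #|Int P a :\: Ext P a| * biy ^+ #|Ext P a :\: Int P a|
     * (bix + biy - 1) ^+ #|Int P a :&: Ext P a|).

(* Polynomials with rational coefficients in variables indexed by a finite
   type V. *)
Notation polyvar V := {mpoly rat[#|{: V}|]}.

Definition var (V : finType) (v : V) : polyvar V := 'X_(enum_rank v).

Definition subst (V : finType) (k : nat) (h : V -> {mpoly rat[k]})
    (p : polyvar V) : {mpoly rat[k]} :=
  p \mPo [tuple h (enum_val i) | i < #|{: V}|].

(* Variables of the universal Tutte polynomial: inl false is x, inl true is y,
   and inr I is z_I for I nonempty. *)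
Definition uvar (n : nat) : finType :=
  (bool + {I : {set 'I_n} | I != set0})%type.

Notation upoly n := (polyvar (uvar n)).

Definition ux (n : nat) : upoly n := var (inl false : uvar n).
Definition uy (n : nat) : upoly n := var (inl true : uvar n).

(* z_I, with the convention that z_I = 0 for I empty. *)
Definition uz (n : nat) (I : {set 'I_n}) : upoly n :=
  if insub I is Some J then var (inr J : uvar n) else 0.

(* T(a, b, (c_I)); the value of c at the empty set is not used. *)
Definition usubst (n k : nat) (T : upoly n) (a b : {mpoly rat[k]})
    (c : {set 'I_n} -> {mpoly rat[k]}) : {mpoly rat[k]} :=
  subst (fun v : uvar n => match v with
                           | inl false => a
                           | inl true => b
                           | inr J => c (val J)
                           end) T.

Definition is_universal_tutte (n : nat) (T : upoly n) : Prop :=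
  forall f : {set 'I_n} -> int, submodular f ->
    usubst T bix biy (fun I => (f I)%:~R) = tutte (Pf f).

(* The ring Q[x, y, (z_I), t_1, ..., t_n], the inclusion of
   Q[x, y, (z_I)] in it, and the variables t_i. *)
Notation utpoly n := (polyvar (uvar n + 'I_n)%type).

Definition ut_incl (n : nat) (p : upoly n) : utpoly n :=
  subst (fun v : uvar n => var (inl v : (uvar n + 'I_n)%type)) p.

Definition ut_t (n : nat) (i : 'I_n) : utpoly n :=
  var (inr i : (uvar n + 'I_n)%type).

(* Main.v *)
Require Import Defs.
From mathcomp Require Import mpoly.
From mathcomp Require Import all_boot all_order all_algebra all_fingroup.
From mathcomp Require Import zify ring.
From mathcomp Require boolp fsbigop classical_sets.

(** A universal Tutte polynomial is determined by its values at the points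
    [(x, y, f)] with [x], [y] odd and [f] submodular, because these points
    contain arbitrarily large grids: strictly submodular functions such as
    [- m * |I|^2] may be perturbed independently at every [I]
    ([submodular_perturb], [mpoly_grid_eq0], [upoly_eq]). It is therefore enough
    to compare Tutte polynomials of polymatroids. Translating or negating the
    polymatroid preserves or swaps the activities, which gives the first two
    symmetries ([tutte_translate], [tutte_dual]).

    The third one says that the Tutte polynomial of [P = Pf f] does not depend
    on the order of the indices, although the activities do. Put
    [x = 1 / (1 - u)] and [y = 1 / (1 - v)]. Expanding geometric series, the term
    of [a] is the sum of [u ^ surplus a c * v ^ surplus c a] over the points [c]
    of the cone of [a], where [c] lies below [a] only in internally active
    coordinates and above [a] only in externally active ones
    ([sum_cone_grid]). These cones tile [Z^n]: the only [a] in [P] whose cone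
    contains [c] is the minimiser over [P] of [sum_k w_k |a_k - c_k|] for positive
    increasing weights [w_k]. Indeed the activity conditions say that no exchange
    lowers this cost ([cone_local_min], [min_cone]), and local minima are global
    by the symmetric exchange property ([Pf_exchange], [local_strict_min]). Since
    this [a] is also nearest to [c] for the L1 distance ([cone_nearest]), the
    exponents [surplus a c] and [surplus c a] depend only on [P] and [c]. So the
    Tutte polynomial is the sum over [c] in [Z^n] of weights that ignore the
    order.

    To have finite sums only, [x] and [y] are taken to be odd integers and the
    identity is read modulo [2 ^ K]: there [u = 1 - 1/x] and [v] are nilpotent
    and [c] may be restricted to a box ([Zp_geometric],
    [sum_term_perm_nilpotent]). As [K] is arbitrary, the integers are equal
    ([tutte_perm]). *)

Set Implicit Arguments.
Unset Strict Implicit.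
Unset Printing Implicit Defensive.

Import Order.TTheory GRing.Theory Num.Theory.
Local Open Scope ring_scope.

(** * Exchanges in the base polymatroid of a submodular function *)

Lemma PfP n (f : {set 'I_n} -> int) (a : 'rV[int]_n) :
  reflect ((forall I : {set 'I_n}, \sum_(k in I) a 0 k <= f I) /\
           \sum_k a 0 k = f [set: 'I_n])
          (a \in Pf f).
Proof.
rewrite /Pf inE.
by apply: (iffP andP) => -[H1 H2]; split; try (exact/forallP); exact/eqP.
Qed.

Definition exchange n (a : 'rV[int]_n) (i j : 'I_n) : 'rV[int]_n :=
  a - basis_vec i + basis_vec j.

Lemma exchangeE n (a : 'rV[int]_n) (i j k : 'I_n) :
  exchange a i j 0 k = a 0 k - (k == i)%:R + (k == j)%:R.
Proof. by rewrite !mxE !eqxx. Qed.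

Lemma exchange_addE n (a : 'rV[int]_n) (i j : 'I_n) :
  a + basis_vec i - basis_vec j = exchange a j i.
Proof. by rewrite /exchange addrAC. Qed.

Lemma sum_indicator n (I : {set 'I_n}) (i : 'I_n) :
  \sum_(k in I) ((k == i)%:R : int) = (i \in I)%:R.
Proof.
case: (boolP (i \in I)) => iI.
  rewrite (bigD1 i) //= eqxx big1 ?addr0 // => k /andP[_ /negPf ->] //.
rewrite big1 // => k kI; case: eqP => // ki; by rewrite -ki kI in iI.
Qed.

Lemma sum_exchange n (a : 'rV[int]_n) (i j : 'I_n) (I : {set 'I_n}) :
  \sum_(k in I) exchange a i j 0 k
  = \sum_(k in I) a 0 k - (i \in I)%:R + (j \in I)%:R.
Proof.
under eq_bigr do rewrite exchangeE.
by rewrite !big_split /= sumrN !sum_indicator.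
Qed.

Lemma sum_setUI n (a : 'rV[int]_n) (I J : {set 'I_n}) :
  \sum_(k in I :|: J) a 0 k + \sum_(k in I :&: J) a 0 k
  = \sum_(k in I) a 0 k + \sum_(k in J) a 0 k.
Proof.
rewrite (big_setID I) /= setUK setDUl setDv set0U.
by rewrite [\sum_(k in J) _](big_setID I) /= [J :&: I]setIC -addrA
  [X in _ + X]addrC.
Qed.

Definition tight n (f : {set 'I_n} -> int) (a : 'rV[int]_n) (I : {set 'I_n}) :=
  \sum_(k in I) a 0 k == f I.

(** Submodularity makes the tight sets of a point a lattice, because
    the sum of the entries of the point is modular and bounded by [f]. *)
Lemma tight_setUI n (f : {set 'I_n} -> int) (a : 'rV[int]_n)
    (I J : {set 'I_n}) :
  submodular f -> a \in Pf f -> tight f a I -> tight f a J ->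
  tight f a (I :|: J) /\ tight f a (I :&: J).
Proof.
move=> [_ sub] /PfP[le_f _] /eqP tI /eqP tJ.
have := sub I J; rewrite -tI -tJ -sum_setUI /tight.
have := le_f (I :|: J); have := le_f (I :&: J).
move: (\sum_(k in I :|: J) _) (\sum_(k in I :&: J) _) => p q.
by move=> *; split; lia.
Qed.

(** Partial sums grow by at most 1, and only over sets containing [j] but not
    [i]; by integrality these have room for it unless they are tight. *)
Lemma exchange_in_Pf n (f : {set 'I_n} -> int) (a : 'rV[int]_n) (i j : 'I_n) :
  a \in Pf f ->
  (forall I : {set 'I_n}, tight f a I -> j \in I -> i \in I) ->
  exchange a i j \in Pf f.
Proof.
move=> /PfP[le_f eq_f] tij; apply/PfP; split=> [I|].
  have := tij I; have := le_f I; rewrite sum_exchange /tight.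
  case: (i \in I); case: (j \in I) => /=; lia.
under eq_bigl => k do rewrite -(in_setT k).
rewrite sum_exchange !in_setT /= -eq_f addrNK.
by apply: eq_bigl => k; rewrite in_setT.
Qed.

(** The symmetric exchange property. The admissible [j] for [a] are those
    outside the largest [a]-tight set [A] avoiding [i], and those for [b] are
    the elements of the smallest [b]-tight set [D] containing [i]; if
    [b <= a] held on [D :\: A], adding the values at [A] and at [D] would
    contradict submodularity. *)
Lemma Pf_exchange n (f : {set 'I_n} -> int) (a b : 'rV[int]_n) (i : 'I_n) :
  submodular f -> a \in Pf f -> b \in Pf f -> b 0 i < a 0 i ->
  exists j : 'I_n,
    [/\ a 0 j < b 0 j, exchange a i j \in Pf f & exchange b j i \in Pf f].
Proof.
move=> subf aP bP lt_i.
have [f0 sub] := subf.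
have [le_fa eq_fa] := PfP _ _ aP; have [le_fb eq_fb] := PfP _ _ bP.
pose A := \bigcup_(I : {set 'I_n} | tight f a I && (i \notin I)) I.
pose D := \bigcap_(I : {set 'I_n} | tight f b I && (i \in I)) I.
have /andP[tA iA] : tight f a A && (i \notin A).
  apply: (big_ind (fun I : {set 'I_n} => tight f a I && (i \notin I))) => //.
    by rewrite /tight big_set0 f0 eqxx inE.
  move=> I J /andP[tI iI] /andP[tJ iJ].
  by rewrite (tight_setUI subf aP tI tJ).1 inE negb_or iI.
have /andP[tD iD] : tight f b D && (i \in D).
  apply: (big_ind (fun I : {set 'I_n} => tight f b I && (i \in I))) => //.
    rewrite /tight inE andbT -eq_fb; apply/eqP.
    by apply: eq_bigl => k; rewrite inE.
  move=> I J /andP[tI iI] /andP[tJ iJ].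
  by rewrite (tight_setUI subf bP tI tJ).2 inE iI.
have aj j : j \notin A -> exchange a i j \in Pf f.
  move=> jA; apply: exchange_in_Pf => // I tI jI; apply: contraNT jA => iI.
  by apply/bigcupP; exists I => //; rewrite tI.
have bj j : j \in D -> exchange b j i \in Pf f.
  move=> jD; apply: exchange_in_Pf => // I tI iI; move/bigcapP: jD; apply.
  by rewrite tI.
have [[j /and3P[jD jA lt_j]]|noj] :=
  altP (@existsP _ (fun j => [&& j \in D, j \notin A & a 0 j < b 0 j])).
  by exists j; split; [|exact: aj|exact: bj].
exfalso.
have le_ba j : j \in D :\: A -> b 0 j <= a 0 j.
  rewrite inE => /andP[jA jD]; rewrite leNgt; apply: contra noj => lt_j.
  by apply/existsP; exists j; rewrite jD jA.
have lt_DA : \sum_(k in D :\: A) b 0 k < \sum_(k in D :\: A) a 0 k.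
  rewrite (bigD1 i) ?inE ?iD ?iA //= [ltRHS](bigD1 i) ?inE ?iD ?iA //=.
  by apply: ltr_leD => //; apply: ler_sum => k /andP[kDA _]; exact: le_ba.
have := sub A D; rewrite -(eqP tA) -(eqP tD).
have := le_fa (A :|: D); have := le_fb (A :&: D).
have := sum_setUI a A D.
rewrite [\sum_(k in D) a 0 k](big_setID A) [\sum_(k in D) b 0 k](big_setID A).
rewrite /= [D :&: A]setIC.
move=> eqU leI leU leUI.
have arith (pU pI pA pD qI qD fU fI : int) : qD < pD ->
    pU + pI = pA + (pI + pD) -> qI <= fI -> pU <= fU ->
    fU + fI <= pA + (qI + qD) -> False by lia.
exact: arith lt_DA eqU leI leU leUI.
Qed.


(** * Minimisation of separable convex costs *)

(** A weighted L1 distance. The weights depend on the coordinate so that they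
    can break ties in the way activities do. *)
Definition cost n (w : 'I_n -> nat) (c a : 'rV[int]_n) : nat :=
  (\sum_k w k * `|(a 0 k - c 0 k)%R|)%N.

(** Each summand is a convex function of one entry, and the two exchanges bring
    the two entries closer to each other. *)
Lemma leq_cost_exchange n (w : 'I_n -> nat) (c a b : 'rV[int]_n)
    (i j : 'I_n) :
  b 0 i < a 0 i -> a 0 j < b 0 j ->
  (cost w c (exchange a i j) + cost w c (exchange b j i) <= cost w c a + cost w c b)%N.
Proof.
move=> lt_i lt_j; rewrite /cost -!big_split /=; apply: leq_sum => k _.
rewrite -!mulnDr leq_mul2l !exchangeE; apply/orP; right.
case: (eqVneq k i) => [->|ki]; case: (eqVneq _ j) => [ij|kj] /=.
- by move: lt_i lt_j; rewrite ij; lia.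
- by lia.
- by rewrite ij; lia.
- by lia.
Qed.

(** For a separable convex cost on an M-convex set, a local strict minimum is
    a global one: exchanging towards [a] lowers the cost of [b]. *)
Lemma local_strict_min n (f : {set 'I_n} -> int) (w : 'I_n -> nat)
    (c a b : 'rV[int]_n) :
  submodular f -> a \in Pf f ->
  (forall i j, i != j -> exchange a i j \in Pf f ->
     (cost w c a < cost w c (exchange a i j))%N) ->
  b \in Pf f -> b != a -> (cost w c a < cost w c b)%N.
Proof.
move=> subf aP loc.
have [m] := ubnP (cost (fun=> 1%N) a b); elim: m b => // m IHm b ltm bP ba.
have [i lt_i] : exists i, b 0 i < a 0 i.
  have [[i lt_i]|noi] := altP (@existsP _ (fun i => b 0 i < a 0 i)).
    by exists i.
  have le_i i : a 0 i <= b 0 i.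
    by rewrite leNgt; apply: contra noi => ?; apply/existsP; exists i.
  case/eqP: ba; apply/rowP => i; apply/eqP; rewrite eq_sym.
  have [_ ea] := PfP _ _ aP; have [_ eb] := PfP _ _ bP.
  have /eqP := etrans eb (esym ea).
  rewrite eq_sym -subr_eq0 -oppr_eq0 opprB -sumrB psumr_eq0; last first.
    by move=> k _; rewrite subr_ge0.
  by move/allP/(_ i (mem_index_enum i)); rewrite subr_eq0 eq_sym.
have [j [lt_j aijP bjiP]] := Pf_exchange subf aP bP lt_i.
have ij : i != j by apply: contraTneq lt_i => ->; rewrite -leNgt ltW.
have := leq_cost_exchange w c lt_i lt_j; have := loc _ _ ij aijP.
have [->|b'a] := eqVneq (exchange b j i) a; first by lia.
have := IHm (exchange b j i) _ bjiP b'a.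
suff lt_dist : (cost (fun=> 1%N) a (exchange b j i) < cost (fun=> 1%N) a b)%N.
  by have := leq_trans lt_dist ltm => /[swap] /[apply]; lia.
rewrite /cost (bigD1 i) //= [X in (_ < X)%N](bigD1 i) //= !exchangeE eqxx (negPf ij).
rewrite -addSn; apply: leq_add => /=; first by lia.
apply: leq_sum => k ki; rewrite !exchangeE (negPf ki) !mul1n.
by case: (eqVneq k j) => [->|kj] /=; lia.
Qed.

(** * The tiling of the lattice by cones *)

(** The region of [Z^n] attached to [a]: one may leave [a] downwards in the
    internally active directions and upwards in the externally active ones. *)
Definition cone n (P : pred 'rV[int]_n) (a c : 'rV[int]_n) : bool :=
  [forall k, ((c 0 k < a 0 k) ==> (k \in Int P a))
          && ((a 0 k < c 0 k) ==> (k \in Ext P a))].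

(** Positive weights increasing with the index: every exchange then changes the
    cost, and when its two changes have opposite signs the larger index
    prevails. For [N] large the cost refines the L1 distance. *)
Definition index_weight n (N : nat) (k : 'I_n) : nat := (N + k).+1.

Lemma cost_exchange n (w : 'I_n -> nat) (c a : 'rV[int]_n) (i j : 'I_n) :
  i != j ->
  (cost w c (exchange a i j) + w i * `|(a 0 i - c 0 i)%R| +
    w j * `|(a 0 j - c 0 j)%R| =
   cost w c a + w i * `|(a 0 i - 1 - c 0 i)%R| +
    w j * `|(a 0 j + 1 - c 0 j)%R|)%N.
Proof.
move=> ij; have ji : j != i by rewrite eq_sym.
rewrite /cost (bigD1 i) //= (bigD1 j) //= [in RHS](bigD1 i) //=.
rewrite [in RHS](bigD1 j) //= !exchangeE !eqxx (negPf ij) (negPf ji) /= subr0 addr0.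
rewrite (eq_bigr (fun k => w k * `|(a 0 k - c 0 k)%R|)%N); last first.
  by move=> k /andP[/negPf ki /negPf kj]; rewrite exchangeE ki kj subr0 addr0.
by lia.
Qed.

Lemma Int_exchange_lt n (P : pred 'rV[int]_n) a (i j : 'I_n) :
  i \in Int P a -> exchange a i j \in P -> i != j -> (i < j)%N.
Proof.
rewrite inE negb_exists => /forallP/(_ j); rewrite -/(exchange a i j) => H aP ij.
by move: H; rewrite aP andbT -leqNgt leq_eqVlt val_eqE (negPf ij).
Qed.

Lemma Ext_exchange_lt n (P : pred 'rV[int]_n) a (i j : 'I_n) :
  j \in Ext P a -> exchange a i j \in P -> i != j -> (j < i)%N.
Proof.
rewrite inE negb_exists => /forallP/(_ i); rewrite exchange_addE => H aP ij.
by move: H; rewrite aP andbT -leqNgt leq_eqVlt val_eqE eq_sym (negPf ij).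
Qed.

(** An exchange out of [a] can lower the cost only by decreasing an entry above
    [c] or by increasing an entry below [c]; these coordinates are active, so
    [Int_exchange_lt] and [Ext_exchange_lt] say which of [i], [j] is smaller,
    and the monotone weights make the change positive. *)
Lemma cone_local_min n (P : pred 'rV[int]_n) (N : nat) (a c : 'rV[int]_n)
    (i j : 'I_n) :
  cone P a c -> i != j -> exchange a i j \in P ->
  (cost (index_weight N) c a < cost (index_weight N) c (exchange a i j))%N.
Proof.
move=> /forallP cac ij aijP.
have := cost_exchange (index_weight N) c a ij.
have /andP[/implyP Ii _] := cac i.
have /andP[_ /implyP Ej] := cac j.
have {Ii} : c 0 i < a 0 i -> (i < j)%N.
  by move=> lti; exact: Int_exchange_lt (Ii lti) aijP ij.
have {Ej} : a 0 j < c 0 j -> (j < i)%N.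
  by move=> ltj; exact: Ext_exchange_lt (Ej ltj) aijP ij.
rewrite /index_weight; move: (cost _ c a) (cost _ c _) => p q.
case: (ltrP (c 0 i) (a 0 i)) => hi; case: (ltrP (a 0 j) (c 0 j)) => hj /=.
- by move=> /(_ isT) ? /(_ isT); lia.
- move=> _ /(_ isT) lt.
  have -> : `|(a 0 i - c 0 i)%R|%N = (`|(a 0 i - 1 - c 0 i)%R|%N).+1 by lia.
  have -> : `|(a 0 j + 1 - c 0 j)%R|%N = (`|(a 0 j - c 0 j)%R|%N).+1 by lia.
  by rewrite !mulnS; lia.
- move=> /(_ isT) lt _.
  have -> : `|(a 0 i - 1 - c 0 i)%R|%N = (`|(a 0 i - c 0 i)%R|%N).+1 by lia.
  have -> : `|(a 0 j - c 0 j)%R|%N = (`|(a 0 j + 1 - c 0 j)%R|%N).+1 by lia.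
  by rewrite !mulnS; lia.
- move=> _ _.
  have -> : `|(a 0 i - 1 - c 0 i)%R|%N = (`|(a 0 i - c 0 i)%R|%N).+1 by lia.
  have -> : `|(a 0 j + 1 - c 0 j)%R|%N = (`|(a 0 j - c 0 j)%R|%N).+1 by lia.
  by rewrite !mulnS; lia.
Qed.

(** An inactive coordinate violating the cone condition would admit an exchange
    with a smaller index, whose weight is smaller, hence a lower cost. *)
Lemma min_cone n (P : pred 'rV[int]_n) (N : nat) (a c : 'rV[int]_n) :
  (forall b, b \in P -> (cost (index_weight N) c a <= cost (index_weight N) c b)%N) ->
  cone P a c.
Proof.
move=> mina; apply/forallP => k; apply/andP; split; apply/implyP => lt_k.
- rewrite inE; apply/negP => /existsP[j /andP[ltj]].
  rewrite -/(exchange a k j) => /mina.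
  have kj : k != j by rewrite -val_eqE neq_ltn ltj orbT.
  have := cost_exchange (index_weight N) c a kj; rewrite /index_weight.
  move: (cost _ c a) (cost _ c _) => p q.
  have -> : `|(a 0 k - c 0 k)%R|%N = (`|(a 0 k - 1 - c 0 k)%R|%N).+1 by lia.
  have : (`|(a 0 j + 1 - c 0 j)%R| <= (`|(a 0 j - c 0 j)%R|).+1)%N by lia.
  by rewrite -(leq_pmul2l (ltn0Sn (N + j))) !mulnS; lia.
- rewrite inE; apply/negP => /existsP[j /andP[ltj]].
  rewrite exchange_addE => /mina.
  have kj : j != k by rewrite -val_eqE neq_ltn ltj.
  have := cost_exchange (index_weight N) c a kj; rewrite /index_weight.
  move: (cost _ c a) (cost _ c _) => p q.
  have -> : `|(a 0 k - c 0 k)%R|%N = (`|(a 0 k + 1 - c 0 k)%R|%N).+1 by lia.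
  have : (`|(a 0 j - 1 - c 0 j)%R| <= (`|(a 0 j - c 0 j)%R|).+1)%N by lia.
  by rewrite -(leq_pmul2l (ltn0Sn (N + j))) !mulnS; lia.
Qed.

Lemma cone_uniq n (f : {set 'I_n} -> int) (a b c : 'rV[int]_n) :
  submodular f -> a \in Pf f -> b \in Pf f ->
  cone (Pf f) a c -> cone (Pf f) b c -> a = b.
Proof.
move=> subf aP bP ca cb; apply/eqP/negPn/negP => ab.
have ltab := local_strict_min subf aP (fun i j => @cone_local_min _ _ 0 _ _ i j ca) bP.
have ltba := local_strict_min subf bP (fun i j => @cone_local_min _ _ 0 _ _ i j cb) aP ab.
by rewrite eq_sym in ab; have := ltab ab; rewrite ltnNge ltnW.
Qed.

Definition nearest n (P : pred 'rV[int]_n) (a c : 'rV[int]_n) : Prop :=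
  a \in P /\ forall b, b \in P -> (cost (fun=> 1%N) c a <= cost (fun=> 1%N) c b)%N.

(** The cone condition does not mention [N], so [a] minimises the cost
    [N * L1 + r] for every [N]; with [N := r b] the L1 part dominates. *)
Lemma cone_nearest n (f : {set 'I_n} -> int) (a c : 'rV[int]_n) :
  submodular f -> a \in Pf f -> cone (Pf f) a c -> nearest (Pf f) a c.
Proof.
move=> subf aP ca; split=> // b bP; have [->//|ba] := eqVneq b a.
rewrite leqNgt; apply/negP => ltba.
pose r (x : 'rV[int]_n) := cost (fun k : 'I_n => k.+1) c x.
have costE N x : cost (index_weight N) c x = (N * cost (fun=> 1%N) c x + r x)%N.
  rewrite /r /cost big_distrr -big_split /=; apply: eq_bigr => k _.
  by rewrite mul1n -mulnDl addnS.
(* The choice [N = r b] contradicts a distance of [b] smaller by 1 or more. *)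
have := local_strict_min subf aP
  (fun i j => @cone_local_min _ _ (r b) _ _ i j ca) bP ba.
by rewrite !costE ltnNge -(subnKC ltba) mulnDr mulnS; lia.
Qed.

Definition pospart (z : int) : nat := if z is Posz m then m else 0.

Definition surplus n (a c : 'rV[int]_n) : nat :=
  (\sum_k pospart (a 0 k - c 0 k)%R)%N.

Definition step_weight (R : comNzRingType) (u v : R) n (a c : 'rV[int]_n) : R :=
  u ^+ surplus a c * v ^+ surplus c a.

(** Both exponents are determined by [f] and [c]: their sum is the distance
    from [c] to the polymatroid, and their difference is [f setT] minus the sum
    of the entries of [c]. *)
Lemma step_weight_nearest (R : comNzRingType) (u v : R) n
    (f : {set 'I_n} -> int) (a b c : 'rV[int]_n) :
  nearest (Pf f) a c -> nearest (Pf f) b c ->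
  step_weight u v a c = step_weight u v b c.
Proof.
move=> [aP mina] [bP minb].
have ecost : cost (fun=> 1%N) c a = cost (fun=> 1%N) c b.
  by apply/eqP; rewrite eqn_leq mina ?minb.
have costE (x : 'rV[int]_n) :
    cost (fun=> 1%N) c x = (surplus x c + surplus c x)%N.
  rewrite /cost -big_split; apply: eq_bigr => k _ /=.
  by rewrite mul1n -opprB; case: (c 0 k - x 0 k) => [[|m]|m] /=; lia.
have sumE (x : 'rV[int]_n) : x \in Pf f ->
    f setT - \sum_k c 0 k = (surplus x c)%:Z - (surplus c x)%:Z.
  move=> /PfP[_ <-]; rewrite -sumrB !(big_morph Posz PoszD erefl) -sumrB.
  apply: eq_bigr => k _ /=.
  by rewrite -opprB; case: (c 0 k - x 0 k) => [[|m]|m] /=; lia.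
have := sumE _ aP; rewrite (sumE _ bP) => esum.
move: ecost; rewrite !costE /step_weight => ecost.
by congr (_ ^+ _ * _ ^+ _); lia.
Qed.

Lemma seq_argmin (T : eqType) (F : T -> nat) (s : seq T) (x : T) :
  x \in s -> exists2 y, y \in s & forall z, z \in s -> (F y <= F z)%N.
Proof.
have [m] := ubnP (F x); elim: m x => // m IHm x ltm xs.
have [/hasP[y ys lty]|/hasPn nolt] := boolP (has (fun y => F y < F x)%N s).
  by apply: IHm ys; exact: leq_trans lty ltm.
by exists x => // z /nolt; rewrite -leqNgt.
Qed.

(** The cones tile [Z^n], so exactly one summand is present, and its weight may
    be computed at any nearest point. The right-hand side does not involve the
    order of the indices. *)
Lemma sum_cone_nearest (R : comNzRingType) (u v : R) n
    (f : {set 'I_n} -> int) (s : seq 'rV[int]_n) (a c : 'rV[int]_n) :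
  submodular f -> uniq s -> s =i Pf f -> nearest (Pf f) a c ->
  \sum_(b <- s | cone (Pf f) b c) step_weight u v b c = step_weight u v a c.
Proof.
move=> subf us sP na; have [aP _] := na.
have [d] := @seq_argmin _ (cost (index_weight 0) c) s a ltac:(by rewrite sP).
rewrite sP => dP mind.
have cd : cone (Pf f) d c by apply: (@min_cone _ _ 0) => b; rewrite -sP => /mind.
rewrite (big_rem d) ?sP //= cd big1_seq ?addr0.
  exact: step_weight_nearest (cone_nearest subf dP cd) na.
move=> b /andP[cb]; rewrite mem_rem_uniq // !inE sP => /andP[/eqP bd bP].
by case: bd; exact: cone_uniq cb cd.
Qed.

(** * Generating functions of cones *)

Definition grid_point n (M : nat) (g : {ffun 'I_n -> 'I_(M + M)}) : 'rV[int]_n :=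
  \row_k ((g k)%:Z - M%:Z).

(** One coordinate of the cone of a point: [z] is the value of that coordinate,
    and [I], [E] tell whether one may step down, or up. *)
Lemma sum_cone_coord (R : comNzRingType) (x y u v : R) (K M : nat) (z : int)
    (I E : bool) :
  (forall m, (K <= m)%N -> \sum_(k < m) u ^+ k = x) ->
  (forall m, (K <= m)%N -> \sum_(k < m) v ^+ k = y) ->
  (absz z + K < M)%N ->
  \sum_(j < M + M) (if ((j%:Z - M%:Z < z) ==> I) && ((z < j%:Z - M%:Z) ==> E)
     then u ^+ pospart (z - (j%:Z - M%:Z)) * v ^+ pospart (j%:Z - M%:Z - z) else 0)
  = (if I then x else 1) + (if E then y else 1) - 1.
Proof.
move=> sumu sumv ltM.
(* Shift by [M]: the box then starts at 0 and [z] becomes the natural number [b]. *)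
have [b eb] : exists b : nat, z = b%:Z - M%:Z by exists (absz (z + M%:Z)); lia.
have ltb : (K <= b)%N by lia.
have ltb' : (b + K < M + M)%N by lia.
pose F j := (if ((j%:Z - M%:Z < z) ==> I) && ((z < j%:Z - M%:Z) ==> E)
  then u ^+ pospart (z - (j%:Z - M%:Z)) * v ^+ pospart (j%:Z - M%:Z - z) else 0).
have FE j : F j = if ((j < b)%N ==> I) && ((b < j)%N ==> E)
    then u ^+ (b - j) * v ^+ (j - b) else 0.
  have ppE p q : pospart ((p%:Z - M%:Z) - (q%:Z - M%:Z)) = (p - q)%N.
    have -> : (p%:Z - M%:Z) - (q%:Z - M%:Z) = p%:Z - q%:Z by lia.
    by case: (leqP p q) => pq; case e: (p%:Z - q%:Z) => [m|m] /=; lia.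
  by rewrite /F eb !ppE !ltrD2r !ltz_nat.
rewrite -(big_mkord xpredT F) (eq_bigr _ (fun j _ => FE j)).
rewrite (big_cat_nat (n := b)) //=; last by lia.
rewrite [X in _ + X]big_ltn; last by lia.
rewrite ltnn subnn mulr1 /=.
have geom (t r : R) m : (forall p, (K <= p)%N -> \sum_(k < p) t ^+ k = r) ->
    (K <= m)%N -> \sum_(0 <= k < m) t ^+ k.+1 = r - 1.
  move=> sumt lem; rewrite -(sumt m.+1) ?(leqW lem) // big_ord_recl expr0.
  by rewrite big_mkord addrAC subrr add0r.
have -> : \sum_(0 <= j < b) (if ((j < b)%N ==> I) && ((b < j)%N ==> E)
    then u ^+ (b - j) * v ^+ (j - b) else 0) = (if I then x else 1) - 1.
  rewrite big_nat_rev /= add0n.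
  rewrite (eq_big_nat _ _ (F2 := fun j => if I then u ^+ j.+1 else 0)); last first.
    move=> j /andP[_ ltj].
    have -> : (b - j.+1 < b)%N by lia.
    have -> : (b < b - j.+1)%N = false by lia.
    have -> : (b - (b - j.+1) = j.+1)%N by lia.
    have -> : (b - j.+1 - b = 0)%N by lia.
    by rewrite mulr1 andbT.
  by case: (I); [exact: geom|rewrite big1 ?subrr].
have -> : \sum_(b.+1 <= j < M + M) (if ((j < b)%N ==> I) && ((b < j)%N ==> E)
    then u ^+ (b - j) * v ^+ (j - b) else 0) = (if E then y else 1) - 1.
  rewrite -[b.+1]add0n big_addn.
  rewrite (eq_big_nat _ _ (F2 := fun j => if E then v ^+ j.+1 else 0)); last first.
    move=> j _.
    have -> : (j + b.+1 < b)%N = false by lia.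
    have -> : (b < j + b.+1)%N by lia.
    have -> : (j + b.+1 - b = j.+1)%N by lia.
    have -> : (b - (j + b.+1) = 0)%N by lia.
    by rewrite mul1r.
  by case: (E); [apply: geom => //; lia|rewrite big1 ?subrr].
by ring.
Qed.

Definition activity_term (R : pzRingType) (x y : R) n (P : pred 'rV[int]_n)
    (a : 'rV[int]_n) : R :=
  x ^+ #|Int P a :\: Ext P a| * y ^+ #|Ext P a :\: Int P a|
  * (x + y - 1) ^+ #|Int P a :&: Ext P a|.

(** The contribution of [a] to the Tutte polynomial is the generating function
    of its cone: expand the product over the coordinates of the geometric series
    of [sum_cone_coord]. *)
Lemma sum_cone_grid (R : comNzRingType) (x y u v : R) (K M n : nat)
    (P : pred 'rV[int]_n) (a : 'rV[int]_n) :
  (forall m, (K <= m)%N -> \sum_(k < m) u ^+ k = x) ->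
  (forall m, (K <= m)%N -> \sum_(k < m) v ^+ k = y) ->
  (forall k, absz (a 0%R k) + K < M)%N ->
  \sum_(g : {ffun 'I_n -> 'I_(M + M)} | cone P a (grid_point g))
     step_weight u v a (grid_point g) = activity_term x y P a.
Proof.
move=> sumu sumv ltM.
have termE : activity_term x y P a = \prod_k ((if k \in Int P a then x else 1) +
    (if k \in Ext P a then y else 1) - 1).
  transitivity (\prod_k ((if k \in Int P a :\: Ext P a then x else 1) *
    (if k \in Ext P a :\: Int P a then y else 1) *
    (if k \in Int P a :&: Ext P a then x + y - 1 else 1))).
    by rewrite !big_split /= -!big_mkcond !prodr_const.
  apply: eq_bigr => k _; rewrite !inE.
  by case: [exists _, _]; case: [exists _, _] => /=; ring.
rewrite termE; under [RHS]eq_bigr => k _ do rewrite -(sum_cone_coord _ _ sumu sumv (ltM k)).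
rewrite bigA_distr_bigA big_mkcond; apply: eq_bigr => g _ /=.
case: ifP => [/forallP ca|/negbT].
  rewrite /step_weight /surplus !(big_morph _ (exprD _) (expr0 _)) -big_split.
  by apply: eq_bigr => k _; have := ca k; rewrite !mxE => ->.
rewrite negb_forall => /existsP[k nk]; rewrite (bigD1 k) //=.
by move: nk; rewrite !mxE => /negPf ->; rewrite mul0r.
Qed.

(** * Evaluation of the Tutte polynomial of a polymatroid *)

Lemma Pf_bounded n (f : {set 'I_n} -> int) :
  exists B, forall (a : 'rV[int]_n) k, a \in Pf f -> (absz (a 0%R k) <= B)%N.
Proof.
exists (\sum_(I : {set 'I_n}) absz (f I)).*2%N => a k /PfP[le_f eq_f].
have le_F I : (absz (f I) <= \sum_(J : {set 'I_n}) absz (f J))%N.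
  by rewrite (bigD1 I) //= leq_addr.
have := le_f [set k]; rewrite big_set1.
have := le_f (~: [set k]); move: eq_f; rewrite (bigD1 k) //=.
rewrite (eq_bigl [in ~: [set k]]); last by move=> j; rewrite !inE.
have arith (ak r fT fC fk : int) (F : nat) : ak + r = fT -> r <= fC ->
    ak <= fk -> (absz fT <= F)%N -> (absz fC <= F)%N -> (absz fk <= F)%N ->
    (absz ak <= F.*2)%N by lia.
by move=> /arith eqT /eqT leC /leC; apply; exact: le_F.
Qed.

Lemma Pf_enum n (f : {set 'I_n} -> int) :
  exists s : seq 'rV[int]_n, uniq s /\ s =i Pf f.
Proof.
have [B leB] := Pf_bounded f; pose M := B.+1.
exists (undup [seq a <- [seq grid_point g | g : {ffun 'I_n -> 'I_(M + M)}] | a \in Pf f]).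
split=> [|a]; first exact: undup_uniq.
rewrite mem_undup mem_filter; apply: andb_idr => aP; apply/imageP.
have arith (z : int) : (absz z <= B)%N ->
    (absz (z + M%:Z)%R < M + M)%N /\ (absz (z + M%:Z)%R)%:Z - M%:Z = z.
  by rewrite /M; lia.
pose g := [ffun k => Ordinal (arith _ (leB _ k aP)).1].
exists g => //; apply/rowP => k; rewrite !mxE ffunE /=.
by rewrite (arith _ (leB _ k aP)).2.
Qed.

Lemma tutte_sum n (P : pred 'rV[int]_n) (s : seq 'rV[int]_n) :
  uniq s -> s =i P -> tutte P = \sum_(a <- s) activity_term bix biy P a.
Proof.
move=> us sP; rewrite fsbigop.fsbig_seq // /tutte.
have -> // : classical_sets.mkset (fun a => a \in P)
  = classical_sets.mkset (fun a => a \in s).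
by apply: boolp.funext => a; rewrite /classical_sets.mkset sP.
Qed.

Lemma activity_term_morph (R S : pzRingType) (phi : {rmorphism R -> S}) (x y : R) n
    (P : pred 'rV[int]_n) (a : 'rV[int]_n) :
  phi (activity_term x y P a) = activity_term (phi x) (phi y) P a.
Proof. by rewrite /activity_term !rmorphM !rmorphXn rmorphB rmorphD rmorph1. Qed.

Definition bipoint (x y : rat) : 'I_2 -> rat := fun i => if i == 0 then x else y.

Lemma tutte_eval n (P : pred 'rV[int]_n) (s : seq 'rV[int]_n) (x y : rat) :
  uniq s -> s =i P ->
  (tutte P).@[bipoint x y] = \sum_(a <- s) activity_term x y P a.
Proof.
move=> us sP; rewrite (tutte_sum us sP) rmorph_sum; apply: eq_bigr => a _.
by rewrite /= (activity_term_morph (meval _)) /= !mevalXU.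
Qed.

(** * Invariance under permutations *)

Lemma submodular_perm n (f : {set 'I_n} -> int) (w : {perm 'I_n}) :
  submodular f -> submodular (fun I : {set 'I_n} => f (w @: I)).
Proof.
move=> [f0 sub]; split=> [|I J]; first by rewrite imset0.
by rewrite imsetU imsetI; [exact: sub|move=> ? ? _ _; exact: perm_inj].
Qed.

Lemma Pf_perm n (f : {set 'I_n} -> int) (w : {perm 'I_n}) (a : 'rV[int]_n) :
  (col_perm w a \in Pf (fun I : {set 'I_n} => f (w @: I))) = (a \in Pf f).
Proof.
have sumE (I : {set 'I_n}) :
    \sum_(k in I) col_perm w a 0 k = \sum_(k in w @: I) a 0 k.
  rewrite big_imset /=; last by move=> ? ? _ _; exact: perm_inj.
  by apply: eq_bigr => k _; rewrite mxE.
have sumT : \sum_k col_perm w a 0 k = \sum_k a 0 k.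
  by rewrite [RHS](reindex_perm w); apply: eq_bigr => k _; rewrite mxE.
have wT : w @: setT = setT by apply/setP => k; rewrite inE -[k](permKV w) imset_f.
apply/PfP/PfP; rewrite sumT wT => -[le_f eq_f]; split=> // I.
  have -> : I = w @: (w^-1%g @: I).
    by rewrite -imset_comp -[LHS]imset_id; apply: eq_imset => k; rewrite /= permKV.
  by rewrite -sumE.
by rewrite sumE.
Qed.

Lemma Pf_perm_enum n (f : {set 'I_n} -> int) (w : {perm 'I_n})
    (s : seq 'rV[int]_n) :
  uniq s -> s =i Pf f ->
  uniq [seq col_perm w a | a <- s] /\
  [seq col_perm w a | a <- s] =i Pf (fun I : {set 'I_n} => f (w @: I)).
Proof.
move=> us sP; have injw : injective (@col_perm int 1 n w).
  move=> a b /rowP ab; apply/rowP => k.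
  by have := ab (w^-1%g k); rewrite !mxE permKV.
split=> [|b]; first by rewrite map_inj_uniq.
have -> : b = col_perm w (col_perm w^-1%g b).
  by apply/rowP => k; rewrite !mxE permK.
by rewrite Pf_perm -sP mem_map.
Qed.

Lemma nearest_perm n (f : {set 'I_n} -> int) (w : {perm 'I_n})
    (a c : 'rV[int]_n) :
  nearest (Pf f) a c ->
  nearest (Pf (fun I : {set 'I_n} => f (w @: I))) (col_perm w a) (col_perm w c).
Proof.
have costE (x : 'rV[int]_n) :
    cost (fun=> 1%N) (col_perm w c) (col_perm w x) = cost (fun=> 1%N) c x.
  rewrite /cost [RHS](reindex_perm w); apply: eq_bigr => k _.
  by rewrite !mxE.
move=> [aP mina]; split=> [|b]; first by rewrite Pf_perm.
have -> : b = col_perm w (col_perm w^-1%g b).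
  by apply/rowP => k; rewrite !mxE permK.
by rewrite Pf_perm !costE; exact: mina.
Qed.

Lemma step_weight_perm (R : comNzRingType) (u v : R) n (w : {perm 'I_n})
    (a c : 'rV[int]_n) :
  step_weight u v (col_perm w a) (col_perm w c) = step_weight u v a c.
Proof.
by congr (_ ^+ _ * _ ^+ _); rewrite /surplus [RHS](reindex_perm w);
  apply: eq_bigr => k _; rewrite !mxE.
Qed.

(** Exchanging the two summations turns each side into a sum over a common box
    of the weights of [sum_cone_nearest], which a permutation of the coordinates
    only relabels. *)
Lemma sum_term_perm_nilpotent (R : comNzRingType) (x y u v : R) (K n : nat)
    (f : {set 'I_n} -> int) (s : seq 'rV[int]_n) (w : {perm 'I_n}) :
  (forall m, (K <= m)%N -> \sum_(k < m) u ^+ k = x) ->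
  (forall m, (K <= m)%N -> \sum_(k < m) v ^+ k = y) ->
  submodular f -> uniq s -> s =i Pf f ->
  \sum_(a <- s) activity_term x y (Pf (fun I : {set 'I_n} => f (w @: I))) (col_perm w a)
  = \sum_(a <- s) activity_term x y (Pf f) a.
Proof.
move=> sumu sumv subf us sP; set f' := fun I : {set 'I_n} => f (w @: I).
have subf' : submodular f' by exact: submodular_perm.
have [B leB] := Pf_bounded f.
pose M := (B + K).+1.
have ltM a : a \in s -> forall k, (absz (a 0%R k) + K < M)%N.
  by rewrite sP => aP k; rewrite ltnS leq_add2r; exact: leB.
have ltM' a : a \in s -> forall k, (absz (col_perm w a 0%R k) + K < M)%N.
  by move=> /ltM + k => /(_ (w k)); rewrite mxE.
rewrite [LHS](eq_big_seq _ (fun a sa => esym (sum_cone_grid _ sumu sumv (ltM' a sa)))).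
rewrite [RHS](eq_big_seq _ (fun a sa => esym (sum_cone_grid _ sumu sumv (ltM a sa)))).
under [LHS]eq_bigr do rewrite big_mkcond; under [RHS]eq_bigr do rewrite big_mkcond.
rewrite exchange_big [RHS]exchange_big /=.
pose pg (g : {ffun 'I_n -> 'I_(M + M)}) := [ffun k => g (w k)].
have pgK : bijective pg.
  exists (fun g : {ffun 'I_n -> 'I_(M + M)} => [ffun k => g (w^-1%g k)]) => g;
  by apply/ffunP => k; rewrite !ffunE ?permK ?permKV.
rewrite (reindex pg) /=; last exact: onW_bij.
apply: eq_bigr => g _.
have -> : grid_point (pg g) = col_perm w (grid_point g).
  by apply/rowP => k; rewrite !mxE ffunE.
rewrite -!big_mkcond /=; move: (grid_point g) => c.
have [us' s'P] := Pf_perm_enum w us sP.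
have [->|[a0 a0s]] : s = [::] \/ exists a, a \in s.
  by case: (s) => [|a0 s1]; [left|right; exists a0; rewrite mem_head].
  by rewrite !big_nil.
(* A point nearest to [c] is carried by [w] to one nearest to the image of [c]. *)
have [a] := seq_argmin (cost (fun=> 1%N) c) a0s.
rewrite sP => aP mina.
have na : nearest (Pf f) a c by split=> // b; rewrite -sP; exact: mina.
rewrite (sum_cone_nearest u v subf us sP na) -(step_weight_perm u v w).
by rewrite -(sum_cone_nearest u v subf' us' s'P (nearest_perm w na)) big_map.
Qed.

(** The element [u = 1 - 1/x] is even, hence nilpotent modulo [2 ^ K], and
    [x = 1 / (1 - u)]; so every long enough geometric sum is exactly [x]. *)
Lemma Zp_geometric (K x m : nat) :
  (0 < K)%N -> odd x -> (K <= m)%N ->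
  \sum_(k < m) (1 - (x%:R)^-1) ^+ k = x%:R :> 'Z_(2 ^ K).
Proof.
move=> K0 ox leK.
have lt1 : (1 < 2 ^ K)%N by rewrite -(expn0 2) ltn_exp2l.
have ux : (x%:R : 'Z_(2 ^ K)) \is a GRing.unit.
  by rewrite unitZpE // coprimeXl // coprime2n.
set X := x%:R in ux *; set u := 1 - X^-1.
have u2 : u = 2%:R * ((x./2)%:R / X).
  rewrite mulrA -natrM mul2n -[X in X%:R / _]addn0 /u.
  have -> : ((x./2.*2 + 0)%N)%:R = X - 1.
    by rewrite addn0 /X -{2}(odd_double_half x) ox natrD addrAC subrr add0r.
  by rewrite mulrBl divrr // mul1r.
have u0 : u ^+ m = 0.
  rewrite -(subnKC leK) exprD u2 exprMn -natrX.
  by rewrite (pchar_Zp lt1) !mul0r.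
have := subrX1 u m; rewrite u0 /u addrAC subrr add0r sub0r mulNr.
by move/oppr_inj/(congr1 (fun t => X * t)); rewrite mulr1 mulrA divrr // mul1r => <-.
Qed.

Lemma int_eq_mod2X (p q : int) :
  (forall K, (0 < K)%N -> p%:~R = q%:~R :> 'Z_(2 ^ K)) -> p = q.
Proof.
move=> eqpq; apply/eqP; rewrite -subr_eq0 -absz_eq0.
set d := p - q; pose K := (absz d).+1.
have lt1 : (1 < 2 ^ K)%N by rewrite -(expn0 2) ltn_exp2l.
have : (d%:~R : 'Z_(2 ^ K)) = 0 by rewrite rmorphB /= eqpq // subrr.
have absR (z : int) : z%:~R = 0 :> 'Z_(2 ^ K) -> (absz z)%:R = 0 :> 'Z_(2 ^ K).
  by case: z => m //; rewrite NegzE mulrNz => /eqP; rewrite oppr_eq0 => /eqP.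
move=> /absR /(congr1 (@nat_of_ord _)); rewrite val_Zp_nat // modn_small.
  by move=> /= ->.
by apply: leq_trans (ltn_expl _ (ltnSn 1)) _; rewrite leq_exp2l.
Qed.

(** Both values are integers, so it is enough to compare them modulo [2 ^ K] for
    every [K], where the geometric series of the cones are finite. *)
Lemma tutte_perm n (f : {set 'I_n} -> int) (w : {perm 'I_n}) (p q : nat) :
  submodular f -> odd p -> odd q ->
  (tutte (Pf (fun I : {set 'I_n} => f (w @: I)))).@[bipoint p%:R q%:R]
  = (tutte (Pf f)).@[bipoint p%:R q%:R].
Proof.
move=> subf op oq; have [s [us sP]] := Pf_enum f.
set f' := fun I : {set 'I_n} => f (w @: I).
have [us' s'P] := Pf_perm_enum w us sP.
rewrite (tutte_eval _ _ us sP).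
rewrite (tutte_eval _ _ us' s'P) big_map.
have intE (P : pred 'rV[int]_n) a : activity_term (p%:R : rat) q%:R P a
    = (activity_term (p%:R : int) q%:R P a)%:~R.
  by rewrite (activity_term_morph intr) !rmorph_nat.
under eq_bigr do rewrite intE; under [RHS]eq_bigr do rewrite intE.
rewrite -!rmorph_sum; congr (_%:~R); apply: int_eq_mod2X => K K0.
rewrite !rmorph_sum /=; under eq_bigr do rewrite (activity_term_morph intr) !rmorph_nat.
under [RHS]eq_bigr do rewrite (activity_term_morph intr) !rmorph_nat.
apply: (sum_term_perm_nilpotent (u := 1 - (p%:R)^-1) (v := 1 - (q%:R)^-1)
  (K := K)) => // m; exact: Zp_geometric.
Qed.

(** * Translation and duality *)

Lemma submodular_translate n (f : {set 'I_n} -> int) (t : 'rV[int]_n) :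
  submodular f -> submodular (fun I => f I + \sum_(i in I) t 0 i).
Proof.
move=> [f0 sub]; split=> [|I J]; first by rewrite f0 big_set0.
by rewrite addrACA sum_setUI [leRHS]addrACA lerD2r.
Qed.

Lemma Pf_translate n (f : {set 'I_n} -> int) (t a : 'rV[int]_n) :
  (a + t \in Pf (fun I => f I + \sum_(i in I) t 0 i)) = (a \in Pf f).
Proof.
have sumE (I : {set 'I_n}) : \sum_(k in I) (a + t) 0 k
    = \sum_(k in I) a 0 k + \sum_(k in I) t 0 k.
  by rewrite -big_split; apply: eq_bigr => k _; rewrite mxE.
rewrite /Pf !inE; congr (_ && _).
  by apply: eq_forallb => I; rewrite sumE lerD2r.
have -> : \sum_i (a + t) 0 i = \sum_i a 0 i + \sum_(i in [set: 'I_n]) t 0 i.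
  have -> : \sum_(i in [set: 'I_n]) t 0 i = \sum_i t 0 i.
    by apply: eq_bigl => k; rewrite inE.
  by rewrite -big_split; apply: eq_bigr => k _; rewrite mxE.
by rewrite (inj_eq (addIr _)).
Qed.

(** Translation by [t] is a bijection between the two polymatroids that
    preserves both kinds of activity. *)
Lemma tutte_translate n (f : {set 'I_n} -> int) (t : 'rV[int]_n) :
  tutte (Pf (fun I => f I + \sum_(i in I) t 0 i)) = tutte (Pf f).
Proof.
have [s [us sP]] := Pf_enum f; set f' := fun I => f I + _.
have inj_t : injective (+%R^~ t) by exact: addIr.
rewrite (tutte_sum us sP) (@tutte_sum _ _ [seq a + t | a <- s]).
- rewrite big_map; apply: eq_bigr => a _; rewrite /activity_term.
  have shift (b c : 'rV[int]_n) : a + t + b + c = a + b + c + t.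
    by rewrite -!addrA [t + _]addrC -!addrA.
  have -> : Int (Pf f') (a + t) = Int (Pf f) a.
    apply/setP => i; rewrite !inE; congr (~~ _); apply: eq_existsb => j.
    by rewrite shift Pf_translate.
  have -> // : Ext (Pf f') (a + t) = Ext (Pf f) a.
  apply/setP => i; rewrite !inE; congr (~~ _); apply: eq_existsb => j.
  by rewrite shift Pf_translate.
- by rewrite map_inj_uniq.
- by move=> b; rewrite -[b](subrK t) (mem_map inj_t) sP Pf_translate.
Qed.

Definition dual_fun n (f : {set 'I_n} -> int) : {set 'I_n} -> int :=
  fun I => f (~: I) - f [set: 'I_n].

Lemma submodular_dual n (f : {set 'I_n} -> int) :
  submodular f -> submodular (dual_fun f).
Proof.
move=> [f0 sub]; split=> [|I J]; first by rewrite /dual_fun setC0 subrr.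
rewrite /dual_fun addrACA [leRHS]addrACA lerD2r setCU setCI addrC.
exact: sub.
Qed.

Lemma Pf_dual n (f : {set 'I_n} -> int) (a : 'rV[int]_n) :
  f set0 = 0 -> (- a \in Pf (dual_fun f)) = (a \in Pf f).
Proof.
move=> f0.
have sumE (I : {set 'I_n}) :
    \sum_(k in I) (- a) 0 k = \sum_(k in ~: I) a 0 k - \sum_k a 0 k.
  rewrite [X in _ - X](bigID [in ~: I]) /= opprD addNKr -sumrN.
  by apply: eq_big => k; rewrite ?inE ?negbK // mxE.
have sumT : \sum_k (- a) 0 k = - \sum_k a 0 k.
  by rewrite -sumrN; apply: eq_bigr => k _; rewrite mxE.
apply/PfP/PfP; rewrite sumT /dual_fun setCT f0 sub0r => -[le_f eq_f].
  have eqT := oppr_inj eq_f; split=> // I.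
  by have := le_f (~: I); rewrite sumE setCK eqT lerD2r.
by split=> [I|]; rewrite ?sumE eq_f // lerD2r.
Qed.

(** Negation is a bijection between the two polymatroids that turns internal
    into external activity. *)
Lemma tutte_dual n (f : {set 'I_n} -> int) (x y : rat) :
  submodular f ->
  (tutte (Pf (dual_fun f))).@[bipoint y x] = (tutte (Pf f)).@[bipoint x y].
Proof.
move=> [f0 _]; have [s [us sP]] := Pf_enum f.
rewrite (tutte_eval _ _ us sP) (@tutte_eval _ _ [seq - a | a <- s]).
- rewrite big_map; apply: eq_bigr => a _; rewrite /activity_term.
  have -> : Int (Pf (dual_fun f)) (- a) = Ext (Pf f) a.
    apply/setP => i; rewrite !inE; congr (~~ _); apply: eq_existsb => j.
    by rewrite -(Pf_dual _ f0) !opprD ?opprK.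
  have -> : Ext (Pf (dual_fun f)) (- a) = Int (Pf f) a.
    apply/setP => i; rewrite !inE; congr (~~ _); apply: eq_existsb => j.
    by rewrite -(Pf_dual _ f0) !opprD ?opprK.
  by rewrite [y + x]addrC [Ext _ _ :&: _]setIC [y ^+ _ * _]mulrC.
- by rewrite map_inj_uniq //; exact: oppr_inj.
- move=> b; rewrite -[b]opprK (mem_map oppr_inj) sP Pf_dual //.
Qed.

(** * Density of submodular functions *)

Lemma vandermonde_unit (F : fieldType) (m : nat) (r : 'I_m -> F) :
  injective r -> Vandermonde m (\row_j r j) \in unitmx.
Proof.
move=> injr; rewrite unitmxE det_Vandermonde unitfE.
apply/prodf_neq0 => i _; apply/prodf_neq0 => j ltij.
by rewrite !mxE subr_eq0 (inj_eq injr) -val_eqE neq_ltn ltij orbT.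
Qed.

(** Inverting the Vandermonde matrix of each variable expresses every coefficient
    of [p] as a linear combination of the values of [p] on the grid. *)
Lemma mpoly_grid_eq0 (F : fieldType) (k m : nat) (p : {mpoly F[k]})
    (r : 'I_k -> 'I_m -> F) :
  (msize p <= m)%N -> (forall i, injective (r i)) ->
  (forall g : {ffun 'I_k -> 'I_m}, p.@[fun i => r i (g i)] = 0) -> p = 0.
Proof.
move=> lepm injr p0; apply/mpolyP => mu; rewrite mcoeff0.
case: (boolP (mu \in msupp p)) => [mup|]; last by rewrite -mcoeff_eq0 => /eqP.
have ltm nu i : nu \in msupp p -> (nu i < m)%N.
  move=> /msize_mdeg_lt ltnu; apply: leq_trans lepm; apply: leq_ltn_trans ltnu.
  by rewrite mdegE (bigD1 i) //= leq_addr.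
pose V i := Vandermonde m (\row_j r i j).
pose L i (j : 'I_m) := invmx (V i) j (Ordinal (ltm mu i mup)).
have VL nu i : nu \in msupp p ->
    \sum_j L i j * r i j ^+ nu i = (nu i == mu i)%:R.
  move=> nup; have := mulmxV (vandermonde_unit (injr i)).
  move/matrixP/(_ (Ordinal (ltm nu i nup)) (Ordinal (ltm mu i mup))).
  rewrite !mxE -val_eqE /= => <-; apply: eq_bigr => j _.
  by rewrite !mxE mulrC.
have : \sum_(g : {ffun 'I_k -> 'I_m})
    (\prod_i L i (g i)) * p.@[fun i => r i (g i)] = 0.
  by rewrite big1 // => g _; rewrite p0 mulr0.
under eq_bigr do rewrite mevalE mulr_sumr.
rewrite exchange_big /= (bigD1_seq mu) //= [X in _ + X]big1_seq => [|nu].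
  move=> <-; rewrite addr0.
  under eq_bigr do rewrite mulrCA -big_split /=.
  rewrite -mulr_sumr -(bigA_distr_bigA (fun i j => L i j * r i j ^+ mu i)).
  by rewrite big1 ?mulr1 // => i _; rewrite VL // eqxx.
move=> /andP[numu nup]; under eq_bigr do rewrite mulrCA -big_split /=.
rewrite -mulr_sumr -(bigA_distr_bigA (fun i j => L i j * r i j ^+ nu i)).
have [i ne_i] : exists i, nu i != mu i.
  apply/existsP; apply: contraNT numu => /existsPn eqi; apply/eqP/mnmP => i.
  by apply/eqP/negPn/eqi.
by rewrite (bigD1 i) //= VL // (negPf ne_i) mul0r mulr0.
Qed.

Definition peval (V : finType) (e : V -> rat) (p : polyvar V) : rat :=
  p.@[fun i => e (enum_val i)].

Lemma peval_var (V : finType) (e : V -> rat) (v : V) : peval e (var v) = e v.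
Proof. by rewrite /peval mevalXU enum_rankK. Qed.

Lemma peval_ext (V : finType) (e e' : V -> rat) (p : polyvar V) :
  e =1 e' -> peval e p = peval e' p.
Proof. by move=> ee'; apply: meval_eq => i; exact: ee'. Qed.

Lemma meval_subst (V : finType) (k : nat) (h : V -> {mpoly rat[k]})
    (p : polyvar V) (e : 'I_k -> rat) :
  (subst h p).@[e] = peval (fun v => (h v).@[e]) p.
Proof.
by rewrite /subst comp_mpoly_meval; apply: meval_eq => i; rewrite tnth_mktuple.
Qed.

Lemma polyvar_eq (V : finType) (p q : polyvar V) :
  (forall m, exists r : V -> nat -> rat, (forall v, injective (r v)) /\
     forall g : V -> nat, (forall v, (g v < m)%N) ->
       peval (fun v => r v (g v)) p = peval (fun v => r v (g v)) q) ->
  p = q.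
Proof.
move=> eqpq; apply/eqP; rewrite -subr_eq0; apply/eqP.
have [r [injr eqr]] := eqpq (msize (p - q)).
apply: (mpoly_grid_eq0 (r := fun i (j : 'I_(msize (p - q))) => r (enum_val i) j)) => //.
  by move=> i j j' /injr/val_inj.
move=> g; rewrite mevalB; apply/eqP; rewrite subr_eq0; apply/eqP.
have eqg i : r (enum_val i) (g (enum_rank (enum_val i : V)))
    = r (enum_val i) (g i) by rewrite enum_valK.
by rewrite -!(meval_eq _ eqg); exact: eqr (fun v => g (enum_rank v)) _.
Qed.

(** If [I] and [J] are incomparable, then
    [|I :|: J|^2 + |I :&: J|^2 - |I|^2 - |J|^2 = 2 |I :\: J| |J :\: I| >= 2], which
    leaves a margin of [2 * m] for the perturbation [g]. *)
Lemma submodular_perturb n (g : {set 'I_n} -> nat) (m : nat) :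
  g set0 = 0%N -> (forall I, (g I <= m)%N) ->
  submodular (fun I => (g I)%:Z - m%:Z * #|I|%:Z ^+ 2).
Proof.
move=> g0 legm; split=> [|I J]; first by rewrite g0 cards0 mulr0.
have [sIJ|nIJ] := boolP (I \subset J).
  by rewrite (setUidPr sIJ) (setIidPl sIJ) addrC.
have [sJI|nJI] := boolP (J \subset I).
  by rewrite (setUidPl sJI) (setIidPr sJI).
have a0 : (0 < #|I :\: J|)%N by rewrite card_gt0 setD_eq0.
have b0 : (0 < #|J :\: I|)%N by rewrite card_gt0 setD_eq0.
have eI := cardsID J I; have eJ := cardsID I J; have eU := cardsUI I J.
rewrite [J :&: I]setIC in eJ.
have eUD : #|I :|: J| = (#|I :\: J| + #|J :\: I| + #|I :&: J|)%N by lia.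
rewrite eUD -eI -eJ.
move: (legm (I :|: J)) (legm (I :&: J)) a0 b0.
move: (g I) (g J) (g (I :|: J)) (g (I :&: J)) => gI gJ gU gC.
move: #|I :\: J| #|J :\: I| #|I :&: J| => a b c leU leC a0 b0.
have leab : m%:Z <= m%:Z * (a%:Z * b%:Z).
  by rewrite -!PoszM lez_nat leq_pmulr // muln_gt0 a0.
suff : (gU%:Z + gC%:Z) <= (gI%:Z + gJ%:Z) + m%:Z * (a%:Z * b%:Z) *+ 2.
  by rewrite !PoszD; lia.
lia.
Qed.

Definition upoint n (R : Type) (x y : R) (z : {set 'I_n} -> R) (v : uvar n) : R :=
  match v with inl false => x | inl true => y | inr J => z (val J) end.

Lemma meval_usubst n k (T : upoly n) (a b : {mpoly rat[k]})
    (c : {set 'I_n} -> {mpoly rat[k]}) (e : 'I_k -> rat) :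
  (usubst T a b c).@[e] = peval (upoint a.@[e] b.@[e] (fun I => (c I).@[e])) T.
Proof. by rewrite meval_subst; apply: peval_ext => -[[]|J]. Qed.

Lemma peval_uz n (x y : rat) (z : {set 'I_n} -> rat) (I : {set 'I_n}) :
  z set0 = 0 -> peval (upoint x y z) (uz I) = z I.
Proof.
move=> z0; rewrite /uz; case: insubP => [J _ <-|]; first by rewrite peval_var.
by rewrite negbK => /eqP ->; rewrite z0 /peval meval0.
Qed.

Definition tutte_point n (p q : nat) (f : {set 'I_n} -> int) : uvar n -> rat :=
  upoint p%:R q%:R (fun I => (f I)%:~R).

Lemma peval_universal n (T : upoly n) (p q : nat) (f : {set 'I_n} -> int) :
  is_universal_tutte T -> submodular f ->
  peval (tutte_point p q f) T = (tutte (Pf f)).@[bipoint p%:R q%:R].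
Proof.
move=> HT subf; rewrite -(HT f subf) meval_usubst; apply: peval_ext.
by case=> [[]|J] /=; rewrite ?mevalXU // rmorph_int.
Qed.

Definition grid_submodular n (m : nat) (g : uvar n -> nat) (I : {set 'I_n}) : int :=
  (if insub I is Some J then g (inr J) else 0%N)%:Z - m%:Z * #|I|%:Z ^+ 2.

Lemma submodular_grid n (m : nat) (g : uvar n -> nat) :
  (forall v, (g v < m)%N) -> submodular (grid_submodular m g).
Proof.
move=> ltgm; apply: submodular_perturb => [|I].
  by rewrite insubF // eqxx.
by case: insub => // J; exact: ltnW.
Qed.

(** The values allowed for each variable: odd numbers for [x] and [y], because of
    [tutte_perm], and for [z_I] the interval where [submodular_perturb] applies. *)
Definition grid_coord n (m : nat) (v : uvar n) (j : nat) : rat :=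
  match v with
  | inl _ => (j.*2.+1)%:R
  | inr J => (j%:Z - m%:Z * #|val J|%:Z ^+ 2)%:~R
  end.

Lemma grid_coord_inj n (m : nat) (v : uvar n) : injective (grid_coord m v).
Proof.
case: v => [b|J] j k /eqP; rewrite /grid_coord.
  by rewrite eqr_nat => /eqP[] /double_inj.
by rewrite eqr_int (inj_eq (addIr _)) => /eqP[].
Qed.

Lemma tutte_point_grid n (m : nat) (g : uvar n -> nat) :
  tutte_point (g (inl false)).*2.+1 (g (inl true)).*2.+1 (grid_submodular m g)
  =1 fun v => grid_coord m v (g v).
Proof.
by case=> [[]|J] //=; rewrite /tutte_point /upoint /grid_submodular valK.
Qed.

(** Submodular functions, together with odd [x] and [y], contain arbitrarily
    large grids, so they are Zariski dense. *)
Lemma upoly_eq n (T T' : upoly n) :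
  (forall (p q : nat) (f : {set 'I_n} -> int),
     odd p -> odd q -> submodular f ->
     peval (tutte_point p q f) T = peval (tutte_point p q f) T') ->
  T = T'.
Proof.
move=> eqT; apply: polyvar_eq => m; exists (grid_coord m).
split=> [v|g ltgm]; first exact: grid_coord_inj.
rewrite -!(peval_ext _ (tutte_point_grid m g)).
apply: eqT; last exact: submodular_grid.
all: by rewrite /= odd_double.
Qed.

Definition translated_point n (p q : nat) (f : {set 'I_n} -> int)
    (t : 'rV[int]_n) (v : uvar n + 'I_n) : rat :=
  match v with inl v => tutte_point p q f v | inr i => (t 0 i)%:~R end.

Lemma utpoly_eq n (T T' : utpoly n) :
  (forall (p q : nat) (f : {set 'I_n} -> int) (t : 'rV[int]_n),
     odd p -> odd q -> submodular f ->
     peval (translated_point p q f t) T = peval (translated_point p q f t) T') ->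
  T = T'.
Proof.
move=> eqT; apply: polyvar_eq => m.
exists (fun v j => match v with inl v => grid_coord m v j | inr _ => j%:R end).
split=> [[v|i]|g ltgm]; first exact: grid_coord_inj.
  by move=> j k /eqP; rewrite eqr_nat => /eqP.
pose h v := g (inl v); pose t : 'rV[int]_n := \row_i (g (inr i))%:Z.
have eqe : translated_point (h (inl false)).*2.+1 (h (inl true)).*2.+1
    (grid_submodular m h) t =1 fun v => match v with
      inl v => grid_coord m v (g (inl v)) | inr i => (g (inr i))%:R end.
  by case=> [v|i] /=; [exact: (tutte_point_grid m h) | rewrite mxE].
have := eqT _ _ _ t _ _ (submodular_grid (g := h) (m := m) (fun v => ltgm _)).
move=> /(_ (h (inl false)).*2.+1 (h (inl true)).*2.+1).
rewrite !(peval_ext _ eqe) /= !odd_double => /(_ isT isT) eqv.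
transitivity (peval (fun v => match v with
      inl v => grid_coord m v (g (inl v)) | inr i => (g (inr i))%:R end) T).
  by apply: peval_ext => -[].
by rewrite eqv; apply: peval_ext => -[].
Qed.

Lemma peval_ut_incl n (e : uvar n + 'I_n -> rat) (T : upoly n) :
  peval e (ut_incl T) = peval (fun v => e (inl v)) T.
Proof.
rewrite [LHS]meval_subst; apply: peval_ext => v.
exact: peval_var.
Qed.

(** * The symmetries *)

Theorem corollary6p7 (n : nat) (n_gt0 : (0 < n)%N) (T : upoly n)
    (HT : is_universal_tutte T) :
  [/\ ut_incl T = usubst T (ut_incl (ux n)) (ut_incl (uy n))
                    (fun I => ut_incl (uz I) + \sum_(i in I) ut_t i),
      T = usubst T (uy n) (ux n) (fun I => uz (~: I) - uz [set: 'I_n]) &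
      forall w : {perm 'I_n},
        T = usubst T (ux n) (uy n) (fun I => uz (w @: I))].
Proof.
split=> [||w].
- apply: utpoly_eq => p q f t op oq subf.
  have [f0 _] := subf.
  rewrite peval_ut_incl (peval_universal _ _ HT subf) -(tutte_translate f t).
  rewrite -(peval_universal _ _ HT (submodular_translate t subf)).
  rewrite [RHS]meval_usubst; apply: peval_ext.
  case=> [[]|J] /=.
  + by rewrite -/(peval _ _) peval_ut_incl peval_var.
  + by rewrite -/(peval _ _) peval_ut_incl peval_var.
  + rewrite mevalD -/(peval _ _) peval_ut_incl (peval_uz _ _ (z := fun I => (f I)%:~R)) ?f0 //.
    rewrite /tutte_point /= rmorphD !rmorph_sum /=; congr (_ + _).
    by apply: eq_bigr => i _; rewrite -/(peval _ _) peval_var.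
- apply: upoly_eq => p q f op oq subf; have [f0 _] := subf.
  rewrite (peval_universal _ _ HT subf) -tutte_dual //.
  rewrite -(peval_universal _ _ HT (submodular_dual subf)).
  rewrite [RHS]meval_usubst; apply: peval_ext.
  case=> [[]|J] /=.
  + by rewrite -/(peval _ _) peval_var.
  + by rewrite -/(peval _ _) peval_var.
  + rewrite mevalB -!/(peval _ _) !(peval_uz _ _ (z := fun I => (f I)%:~R)) ?f0 //.
    by rewrite /tutte_point /= rmorphB.
- apply: upoly_eq => p q f op oq subf; have [f0 _] := subf.
  rewrite (peval_universal _ _ HT subf) -(tutte_perm w subf op oq).
  rewrite -(peval_universal _ _ HT (submodular_perm w subf)).
  rewrite [RHS]meval_usubst; apply: peval_ext.
  case=> [[]|J] /=.
  + by rewrite -/(peval _ _) peval_var.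
  + by rewrite -/(peval _ _) peval_var.
  + by rewrite -/(peval _ _) (peval_uz _ _ (z := fun I => (f I)%:~R)) ?f0.
Qed.
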